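(* For every real $\epsilon > \frac{1}{3}$ there exists a finite bipartite graph $G_\epsilon$ with bipartition $(L,R)$ such that each vertex in $L$ has degree at most $3$, no two distinct degree-$3$ vertices of $L$ have the same set of neighbours, $|N_{G_\epsilon}(L)| \geq (2-\epsilon)|L|$, every proper subset of $L$ can be covered by a $(2,4)$-matching in $G_\epsilon$, but $L$ cannot be covered by a $(2,4)$-matching in $G_\epsilon$.
   Context: For a bipartite graph $G$ with bipartition $(L,R)$, a $(2,4)$-matching in $G$ is a subgraph $F$ of $G$ such that (1) each connected component of $F$ is a tree with at most $4$ edges, and (2) each vertex in $V(F)\cap L$ has degree exactly $2$ in $F$. A $(2,4)$-matching $F$ covers a set of vertices $S$ if $S \subseteq V(F)$. $N_G(A)$ denotes the set of neighbours in $G$ of vertices of $A$. *)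

(* Defs.v *)
From HB Require Import structures.
From mathcomp Require Import all_boot all_order all_algebra.
From mathcomp Require Import reals.

Set Implicit Arguments.
Unset Strict Implicit.
Unset Printing Implicit Defensive.

(* A finite simple graph whose vertices are taken from an
   ambient finite type T; edges are unordered pairs of distinct vertices.
   Keeping the vertex set separate from T makes subgraphs graphs on the same
   type. *)
Record graph (T : finType) := Graph {
  vertices : {set T};
  edges : {set {set T}};
  edgesP : forall e : {set T}, e \in edges -> #|e| = 2 /\ e \subset vertices
}.

Section Graphs.

Variable T : finType.
Implicit Types (F G H : graph T) (x y v : T) (A S L R : {set T}).

(* Irreflexive, since [set x; x] has cardinality 1. *)
Definition adj G : rel T := fun x y => [set x; y] \in edges G.

Definition neighbours G x : {set T} := [set y | adj G x y].

Definition nbhd G A : {set T} := \bigcup_(x in A) neighbours G x.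

Definition degree G x : nat := #|neighbours G x|.

Definition bipartition G L R : Prop :=
  [/\ L :|: R = vertices G,
      [disjoint L & R] &
      forall x y, adj G x y -> (x \in L /\ y \in R) \/ (x \in R /\ y \in L)].

Definition subgraph F G : Prop :=
  vertices F \subset vertices G /\ edges F \subset edges G.

Lemma induced_edgesP G S (e : {set T}) :
  e \in [set e in edges G | e \subset S] ->
  #|e| = 2 /\ e \subset vertices G :&: S.
Proof.
rewrite inE => /andP[/edgesP[e2 eG] eS]; split=> //.
by rewrite subsetI eG eS.
Qed.

Definition induced G S : graph T := Graph (@induced_edgesP G S).

Definition component G x : graph T := induced G [set y | connect (adj G) x y].

Definition connected G : Prop :=
  vertices G != set0 /\
  {in vertices G &, forall x y, connect (adj G) x y}.

(* The size bound matters: ucycle also accepts the degenerate closed walks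
   [::] and [:: x; y]. *)
Definition acyclic G : Prop :=
  forall c : seq T, 2 < size c -> ~ ucycle (adj G) c.

Definition is_tree G : Prop := connected G /\ acyclic G.

Definition matching24 G L F : Prop :=
  [/\ subgraph F G,
      {in vertices F, forall x,
         is_tree (component F x) /\ #|edges (component F x)| <= 4} &
      {in vertices F :&: L, forall v, degree F v = 2}].

Definition covers F A : Prop := A \subset vertices F.

Definition coverable24 G L A : Prop :=
  exists F : graph T, matching24 G L F /\ covers F A.

End Graphs.

(* Main.v *)
(* View L as hyperedges of size at most 3 on the point set R. Covering L means
   choosing a pair inside each hyperedge so that the chosen pairs form disjoint
   paths with at most two pairs each.  For 0 <= i <= k take the hyperedges
     e_i = {p_i, b_i, q_i}, f_i = {b_i, c_i}, g_i = {p_i, r_i, q_(i-1)},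
   where q_k and q_(-1) are omitted: 3(k+1) hyperedges on 5(k+1)-1 points,
   so |N(L)| / |L| tends to 5/3 = 2 - 1/3.
   The pair of g_0 contains p_0.  If the pair of g_i contains p_i but that of
   g_(i+1) misses p_(i+1), then g_(i+1) uses q_i, and whatever pair e_i takes,
   it joins two of f_i, g_i, g_(i+1).  So every g_i uses p_i, and at i = k the
   pairs of g_k, e_k, f_k form a path of length 3.  Deleting any one hyperedge
   stops this propagation. *)
Require Import Defs.
From HB Require Import structures.
From mathcomp Require Import all_boot all_order all_algebra.
From mathcomp Require Import reals lra.

Set Implicit Arguments.
Unset Strict Implicit.
Unset Printing Implicit Defensive.

Import Order.TTheory GRing.Theory Num.Theory.

(** * Adjacency, connected components and cycles *)

Section GraphTheory.

Variable T : finType.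
Implicit Types (F G : graph T) (x y z : T) (L S : {set T}).

Lemma adjC G x y : adj G x y = adj G y x.
Proof. by rewrite /adj setUC. Qed.

Lemma adj_vertices G x y : adj G x y -> x \in vertices G /\ y \in vertices G.
Proof.
by move=> /edgesP[_ /subsetP sG]; split; apply: sG; rewrite !inE eqxx ?orbT.
Qed.

Lemma connect_adjC G : connect_sym (adj G).
Proof. by apply: sym_connect_sym => x y; rewrite adjC. Qed.

Lemma degree_gt1 G x y z : adj G x y -> adj G x z -> y != z -> 1 < degree G x.
Proof.
move=> xy xz yz; rewrite /degree (cardD1 y) (cardD1 z) !inE xy xz.
by rewrite (eq_sym z) yz.
Qed.

Lemma degree_gt2 G x y z t : adj G x y -> adj G x z -> adj G x t ->
  y != z -> y != t -> z != t -> 2 < degree G x.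
Proof.
move=> xy xz xt yz yt zt.
rewrite /degree (cardD1 y) (cardD1 z) (cardD1 t) !inE xy xz xt.
by rewrite (eq_sym z) yz (eq_sym t) zt (eq_sym t) yt.
Qed.

Lemma adj_component G x y z :
  adj (component G x) y z =
  [&& adj G y z, connect (adj G) x y & connect (adj G) x z].
Proof. by rewrite /adj inE /= subUset !sub1set !inE. Qed.

(** Every prefix of a path from [x] ends inside the component of [x], so each step of the path
    survives in the induced subgraph. *)
Lemma connect_component G x y :
  connect (adj G) x y -> connect (adj (component G x)) x y.
Proof.
move=> /connectP[p]; elim/last_ind: p y => [|p z IHp] y /=.
  by move=> _ ->; exact: connect0.
rewrite rcons_path last_rcons => /andP[xp pz] ->.
have cp : connect (adj G) x (last x p) by apply/connectP; exists p.
apply: connect_trans (IHp _ xp erefl) (connect1 _).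
by rewrite adj_component pz cp (connect_trans cp (connect1 pz)).
Qed.

Lemma component_connected G x :
  x \in vertices G -> connected (component G x).
Proof.
move=> xG; split.
  by apply/set0Pn; exists x; rewrite !inE xG connect0.
move=> y z; rewrite !inE => /andP[_ /connect_component xy].
move=> /andP[_ /connect_component xz].
by apply: connect_trans xz; rewrite connect_adjC.
Qed.

Lemma sub_acyclic F G : subrel (adj F) (adj G) -> acyclic G -> acyclic F.
Proof.
move=> sFG acG c c2 /andP[cF uc]; apply: (acG c c2).
by rewrite /ucycle uc (sub_cycle sFG cF).
Qed.

(** Once the cycle is rotated to start at [x], its second and last vertices serve; they differ
    because the cycle has length at least 3 and no repetition. *)
Lemma cycle_two_neighbours G (c : seq T) x :
  2 < size c -> ucycle (adj G) c -> x \in c ->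
  exists y z, [/\ y != z, y \in c, z \in c, adj G x y & adj G x z].
Proof.
move=> c2 /andP[cG uc] xc; have [i c' ci] := rot_to xc.
move: c2 cG uc; rewrite -(size_rot i) -(rot_cycle i) -(rot_uniq i) ci.
have mc : c =i x :: c' by move=> y; rewrite -ci mem_rot.
case: c' {ci} mc => [|y c'] // mc; case/lastP: c' mc => [|c' z] // mc _.
rewrite /= rcons_path last_rcons => /and3P[xy _ zx].
rewrite mem_rcons inE negb_or => /and3P[_ /andP[yz _] _].
exists y, z; split=> //; rewrite ?mc ?inE ?mem_rcons ?inE ?eqxx ?orbT //.
by rewrite adjC.
Qed.

Lemma component_sub G S x y :
  (forall u v, adj G u v -> u \in S -> v \in S) -> x \in S ->
  connect (adj G) x y -> y \in S.
Proof.
move=> clS xS /connectP[p]; elim: p x xS => [|z p IHp] x xS /= => [_ ->//|].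
by case/andP=> /clS/(_ xS)/IHp. 
Qed.

(** * A local criterion: every vertex of [L] has a leaf as neighbour *)

Section Criterion.

Variables (F : graph T) (L : {set T}).
Hypothesis bipF : forall x y, adj F x y -> (x \in L) = (y \notin L).
Hypothesis degF : forall x, degree F x <= 2.
Hypothesis leafF :
  {in vertices F :&: L, forall x, exists2 y, adj F x y & degree F y <= 1}.

(** A cycle meets [L] in some [x], whose two cycle neighbours are all its neighbours. So the leaf
    next to [x] would lie on the cycle and have degree at least 2. *)
Lemma leaves_acyclic : acyclic F.
Proof.
move=> c c2 ucF.
have [x xc xL] : exists2 x, x \in c & x \in L.
  have [u uc] : exists u, u \in c.
    by case: (c) c2 => [//|u c'] _; exists u; exact: mem_head.
  have [y [_ [_ yc _ uy _]]] := cycle_two_neighbours c2 ucF uc.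
  have [uL|uL] := boolP (u \in L); first by exists u.
  by exists y; rewrite // (bipF (y := u)) // adjC.
have [y [z [yz yc zc xy xz]]] := cycle_two_neighbours c2 ucF xc.
have [|w xw w1] := leafF (x := x); first by rewrite inE xL (adj_vertices xy).1.
suff wc : w \in c.
  have [u [v [uv _ _ wu wv]]] := cycle_two_neighbours c2 ucF wc.
  by rewrite leqNgt (degree_gt1 wu wv uv) in w1.
have: w \in [set y; z].
  suff /eqP-> : [set y; z] == neighbours F x by rewrite inE.
  rewrite eqEcard cards2 yz; apply/andP; split; last exact: degF.
  by apply/subsetP=> u; rewrite !inE => /orP[]/eqP->.
by rewrite !inE => /orP[]/eqP->.
Qed.

(* Around c the graph is a subdivided star. *)
Let center c := c \notin L /\
  forall x y, adj F c x -> adj F x y -> y != c -> degree F y <= 1.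

(** The set [S] of vertices within distance 2 of [c] is closed under adjacency, so it contains the
    component. Each edge has an end in [L], which must be a neighbour of [c]; there are at most 2 of
    these, with at most 2 edges each. *)
Lemma center_edges c x :
  center c -> adj F c x \/ c = x \/ (exists2 y, adj F c y & adj F y x) -> 
  #|edges (component F x)| <= 4.
Proof.
move=> [cL cP] cx.
pose S := c |: (neighbours F c :|: nbhd F (neighbours F c)).
have inS y : reflect (adj F c y \/ c = y \/ (exists2 z, adj F c z & adj F z y))
    (y \in S).
  rewrite !inE; apply: (iffP or3P).
    case=> [/eqP->|cy|/bigcupP[z]]; [by right; left|by left|].
    by rewrite !inE => cz zy; right; right; exists z.
  case=> [cy|[->|[z cz zy]]]; [by constructor 2|by constructor 1|].
  by constructor 3; apply/bigcupP; exists z; rewrite inE.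
have clS u v : adj F u v -> u \in S -> v \in S.
  move=> uv /inS[cu|[cu|[z cz zu]]]; apply/inS.
  - by right; right; exists u.
  - by left; rewrite cu.
  - have [cu|cu] := eqVneq c u; first by left; rewrite cu.
    have := cP z u cz zu; rewrite eq_sym cu => /(_ isT).
    have [zv|zv] := eqVneq z v; first by left; rewrite -zv.
    by rewrite leqNgt (degree_gt1 _ uv zv) // adjC.
have NcL y : adj F c y -> y \in L by move=> cy; rewrite (bipF (y := c)) // adjC.
apply: (@leq_trans #|\bigcup_(y in neighbours F c)
          [set [set y; z] | z in neighbours F y]|).
  apply/subset_leq_card/subsetP => e; rewrite !inE => /andP[eF /subsetP eS].
  have /edgesP[/eqP/cards2P[u [v [uv def_e]]] _] := eF.
  have cv : {subset e <= S}.
    by move=> w /eS; rewrite inE; apply: component_sub => //; apply/inS.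
  wlog uL : u v uv def_e / u \in L => [hw|].
    have uvF : adj F u v by rewrite /adj -def_e.
    have [uL|uL] := boolP (u \in L); first exact: (hw u v).
    apply: (hw v u); rewrite 1?eq_sym // ?def_e 1?setUC //.
    by rewrite (bipF (y := u)) // adjC.
  have uvF : adj F u v by rewrite /adj -def_e.
  have uS : u \in S by apply: cv; rewrite def_e !inE eqxx.
  apply/bigcupP; exists u; last by apply/imsetP; exists v; rewrite ?inE.
  rewrite inE; case/inS: uS => [//|[cu|[z /NcL zL /bipF]]].
    by rewrite -cu (negPf cL) in uL.
  by rewrite zL uL.
have sumle : #|\bigcup_(y in neighbours F c)
    [set [set y; z] | z in neighbours F y]| <=
    \sum_(y in neighbours F c) 2.
  elim/big_rec2: _ => [|y m X _ le_X]; first by rewrite cards0.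
  rewrite (leq_trans (leq_card_setU _ _)) // leq_add //.
  exact: leq_trans (leq_imset_card _ _) (degF y).
apply: leq_trans sumle _; rewrite sum_nat_const.
exact: (leq_mul (degF c) (leqnn 2)).
Qed.

(** Let [w] be the leaf of a neighbour [u] of [c]. If [w] is [c], then [u] is [x] and [v] is [y];
    otherwise [c] and [w] are the only neighbours of [u], so [v] is [w]. *)
Lemma leaf_center x y c : x \in L -> adj F x y -> degree F y <= 1 ->
  adj F x c -> (forall z, adj F x z -> z = y \/ z = c) -> center c.
Proof.
move=> xL xy y1 xc Nx; have cL : c \notin L by rewrite -(bipF xc).
split=> // u v cu uv vc.
have uL : u \in L by rewrite (bipF (y := c)) // adjC.
have [|w uw w1] := leafF (x := u).
  by rewrite inE uL (adj_vertices uv).1.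
have [wc|wc] := eqVneq w c.
  have ux : u = x.
    apply/eqP/negPn/negP => ux; move: w1; rewrite wc leqNgt.
    by rewrite (degree_gt1 cu _ ux) // adjC.
  by move: uv; rewrite ux => /Nx[->//|vc']; rewrite vc' eqxx in vc.
have [->//|vw] := eqVneq v w.
have uc : adj F u c by rewrite adjC.
by have := degree_gt2 uv uw uc vw vc wc; rewrite ltnNge degF.
Qed.

(** A vertex of [L] is adjacent to a center, any other vertex with a neighbour is within distance 2
    of one, and an isolated vertex outside [L] is its own center. *)
Lemma leaves_edges x : x \in vertices F -> #|edges (component F x)| <= 4.
Proof.
move=> xF.
have Lcenter u : u \in L -> u \in vertices F ->
    exists y c, [/\ center c, adj F u c & forall z, adj F u z -> z = y \/ z = c].
  move=> uL uF; have [|y uy y1] := leafF (x := u); first by rewrite inE uF.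
  have [c uc Nu] : exists2 c, adj F u c & forall z, adj F u z -> z = y \/ z = c.
    have [c /andP[uc cy]|N1] := pickP [pred c | adj F u c && (c != y)].
      exists c => // z uz; have [->|zy] := eqVneq z y; first by left.
      have [->|zc] := eqVneq z c; first by right.
      by have := degree_gt2 uz uc uy zc zy cy; rewrite ltnNge degF.
    (* With no second neighbour, the leaf itself plays the part of [c]. *)
    exists y => // z uz; left; apply/eqP/negPn/negP => zy.
    by have := N1 z; rewrite /= uz zy.
  exists y, c; split=> //; exact: leaf_center uL uy y1 uc Nu.
have [xL|xL] := boolP (x \in L).
  have [y [c [cc xc _]]] := Lcenter x xL xF.
  by apply: center_edges cc _; left; rewrite adjC.
have [u xu|N0] := pickP (adj F x); last first.
  apply: (@center_edges x); last by right; left.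
  by split=> // y z; rewrite N0.
have ux : adj F u x by rewrite adjC.
have uL : u \in L by rewrite (bipF ux).
have [y [c [cc uc Nu]]] := Lcenter u uL (adj_vertices ux).1.
apply: center_edges cc _.
by right; right; exists u; rewrite // adjC.
Qed.

End Criterion.
End GraphTheory.

(** * (2,4)-matchings: a sufficient condition and an obstruction *)

Section Matchings.

Variables (T : finType) (G : graph T) (L R : {set T}).
Hypothesis bipG : bipartition G L R.

Lemma bipartition_adj x y : adj G x y -> (x \in L) = (y \notin L).
Proof.
have [_ dLR bG] := bipG.
have RL z : z \in R -> z \notin L.
  by move=> zR; rewrite (disjointFl dLR zR).
by case/bG=> -[xs ys]; rewrite ?xs ?ys ?RL // (negPf (RL _ xs)).
Qed.

Lemma subgraph_adj (F : graph T) x y : subgraph F G -> adj F x y -> adj G x y.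
Proof. by case=> _ /subsetP; apply. Qed.

Lemma matching24_local F : subgraph F G -> (forall x, degree F x <= 2) ->
  {in vertices F :&: L, forall x, degree F x = 2} ->
  {in vertices F :&: L, forall x, exists2 y, adj F x y & degree F y <= 1} ->
  matching24 G L F.
Proof.
move=> sFG deg2 degL leafF.
have bipF x y : adj F x y -> (x \in L) = (y \notin L).
  by move/(subgraph_adj sFG); exact: bipartition_adj.
split=> // x xF; split; last exact: leaves_edges bipF deg2 leafF x xF.
split; first exact: component_connected.
apply: sub_acyclic (leaves_acyclic bipF deg2 leafF) => y z.
by rewrite adj_component => /and3P[].
Qed.

(** Each of the three vertices carries two edges, and no edge has both ends in [L], so the component
    would have at least 6 edges. *)
Lemma matching24_component F x y z : matching24 G L F ->
  covers F L -> x \in L -> y \in L -> z \in L -> x != y -> x != z -> y != z ->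
  connect (adj F) x y -> connect (adj F) x z -> False.
Proof.
move=> [sFG compF degF] /subsetP LF xL yL zL xy xz yz cxy cxz.
pose E u := [set [set u; w] | w in neighbours F u].
have bipF u w : u \in L -> adj F u w -> w \notin L.
  by move=> uL /(subgraph_adj sFG)/bipartition_adj <-.
have cardE u : u \in L -> #|E u| = 2.
  move=> uL; rewrite card_in_imset; first by apply: degF; rewrite inE uL LF.
  move=> w w'; rewrite !inE => uw uw' eq_ww'.
  have: w \in [set u; w'] by rewrite -eq_ww' !inE eqxx orbT.
  by rewrite !inE => /orP[]/eqP // wu; have := bipF _ _ uL uw; rewrite wu uL.
have disjE u v : u \in L -> v \in L -> u != v -> E u :&: E v = set0.
  move=> uL vL uv; apply/setP => e; rewrite !inE; apply/andP => -[].
  move=> /imsetP[w + ->] /imsetP[w' _ eq_e]; rewrite inE => uw.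
  have: v \in [set u; w] by rewrite eq_e !inE eqxx.
  rewrite !inE eq_sym (negPf uv) => /eqP vw.
  by have := bipF _ _ uL uw; rewrite -vw vL.
have sE u : connect (adj F) x u -> E u \subset edges (component F x).
  move=> xu; apply/subsetP => _ /imsetP[w + ->]; rewrite inE => uw.
  rewrite -[_ \in _]/(adj (component F x) u w) adj_component uw xu.
  exact: connect_trans xu (connect1 uw).
have [_] := compF x (LF x xL); apply/negP; rewrite -ltnNge.
apply: (@leq_trans #|E x :|: E y :|: E z|); last first.
  by apply: subset_leq_card; rewrite !subUset !sE ?connect0.
by rewrite !cardsU setIUl !disjE // setU0 cards0 !cardE.
Qed.

End Matchings.

(** * Incidence graphs of hypergraphs *)

Section IncidenceGraph.

Variables (A B : finType).
Implicit Types (h : A -> {set B}) (a : A) (b : B) (F : graph (A + B)%type).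

Definition lefts : {set A + B} := [set x | if x is inl _ then true else false].
Definition rights : {set A + B} := [set x | if x is inr _ then true else false].

Lemma card_lefts : #|lefts| = #|A|.
Proof.
rewrite -cardsT -(card_imset _ (@inl_inj A B)); apply: eq_card => -[a|b].
  by rewrite !inE (mem_imset _ _ inl_inj) inE.
by rewrite inE; apply/esym/imsetP => -[].
Qed.

(** Dropping hyperedges without points lets a partial matching be an incidence graph too: uncovered
    hyperedges receive the empty set. *)
Definition incidence_vertices h : {set A + B} :=
  [set x | if x is inl a then h a != set0 else true].

Definition incidence_edges h : {set {set A + B}} :=
  \bigcup_a [set [set inl a; inr b] | b in h a].

Lemma incidence_edgesP h e : e \in incidence_edges h ->
  #|e| = 2 /\ e \subset incidence_vertices h.
Proof.
move=> /bigcupP[a _ /imsetP[b hb ->]]; rewrite cards2; split=> //.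
by rewrite subUset !sub1set !inE andbT; apply/set0Pn; exists b.
Qed.

Definition incidence h : graph (A + B)%type := Graph (@incidence_edgesP h).

Lemma incidence_adjP h x y : adj (incidence h) x y ->
  exists a b, b \in h a /\ ((x, y) = (inl a, inr b) \/ (x, y) = (inr b, inl a)).
Proof.
move=> xy; have [x_y _] := edgesP xy; move: xy.
move=> /bigcupP[a _ /imsetP[b hb eq_e]]; exists a, b; split=> //.
have: x \in [set inl a; inr b] by rewrite -eq_e !inE eqxx.
have: y \in [set inl a; inr b] by rewrite -eq_e !inE eqxx orbT.
by rewrite !inE => /orP[]/eqP Dy /orP[]/eqP Dx; subst x y;
  rewrite ?setUid ?cards1 // in x_y; [right|left].
Qed.

Lemma incidence_adj h a b : adj (incidence h) (inl a) (inr b) = (b \in h a).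
Proof.
apply/idP/idP => [/incidence_adjP[a' [b' [hb' []//]]] [-> ->] //|hb].
by apply/bigcupP; exists a => //; apply/imsetP; exists b.
Qed.

Lemma incidence_bipartition h : (forall a, h a != set0) ->
  bipartition (incidence h) lefts rights.
Proof.
move=> h0; split.
- by apply/setP => -[a|b]; rewrite !inE ?h0.
- by rewrite -setI_eq0; apply/eqP/setP => -[a|b]; rewrite !inE.
- by move=> x y /incidence_adjP[a [b [_ [[-> ->]|[-> ->]]]]]; rewrite !inE; auto.
Qed.

Lemma incidence_neighbours h a :
  neighbours (incidence h) (inl a) = inr @: h a.
Proof.
apply/setP => y; rewrite inE; apply/idP/imsetP => [|[b hb ->]].
  by case/incidence_adjP=> a' [b [hb [] [] // -> ->]]; exists b.
by rewrite incidence_adj.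
Qed.

Lemma incidence_degreel h a : degree (incidence h) (inl a) = #|h a|.
Proof. by rewrite /degree incidence_neighbours card_imset //; exact: inr_inj. Qed.

Lemma incidence_degreer h b :
  degree (incidence h) (inr b) = #|[set a | b \in h a]|.
Proof.
rewrite /degree -(card_imset _ (@inl_inj A B)); apply: eq_card => y.
rewrite inE; apply/idP/imsetP => [|[a + ->]].
  by case/incidence_adjP=> a [b' [hb [] [] // -> ->]]; exists a; rewrite ?inE.
by rewrite adjC incidence_adj inE.
Qed.

Lemma incidence_sub h h' :
  (forall a, h' a \subset h a) -> subgraph (incidence h') (incidence h).
Proof.
move=> sh; split; apply/subsetP.
  case=> [a|b]; rewrite !inE // -!card_gt0 => /leq_trans; apply.
  exact: subset_leq_card.
move=> e /bigcupP[a _ /imsetP[b hb ->]].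
have /bigcupP[a' _ ?] : [set inl a; inr b] \in edges (incidence h).
  by rewrite -[_ \in _]/(adj _ _ _) incidence_adj (subsetP (sh a)).
by apply/bigcupP; exists a'.
Qed.

(** The pairs [s a] with [a != v] form the matching. The private point of each pair is the leaf that
    the local criterion asks for. *)
Lemma incidence_matching h (s : A -> {set B}) v : (forall a, h a != set0) ->
  (forall b, #|[set a | b \in h a]| <= 2) ->
  (forall a, s a \subset h a) -> (forall a, #|s a| = 2) ->
  (forall a, a != v ->
     exists2 b, b \in s a & forall a', a' != v -> b \in s a' -> a' = a) ->
  coverable24 (incidence h) lefts (lefts :\ inl v).
Proof.
move=> h0 h2 sh s2 priv; pose s' a := if a == v then set0 else s a.
have ss a : s' a \subset s a by rewrite /s'; case: ifP; rewrite ?sub0set.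
have sh' a : s' a \subset h a := subset_trans (ss a) (sh a).
have s'v a : s' a != set0 -> a != v by rewrite /s'; case: (a == v); rewrite ?eqxx.
exists (incidence s'); split.
  apply: (matching24_local (incidence_bipartition h0)).
  - exact: incidence_sub.
  - case=> [a|b]; rewrite ?incidence_degreel ?incidence_degreer.
      by rewrite -(s2 a) subset_leq_card.
    apply: leq_trans (h2 b); apply/subset_leq_card/subsetP => a.
    by rewrite !inE; apply: (subsetP (sh' a)).
  - case=> [a|b]; rewrite !inE ?andbF // andbT => /s'v av.
    by rewrite incidence_degreel /s' (negPf av).
  - case=> [a|b]; rewrite !inE ?andbF // andbT => /s'v av.
    have [b sb pb] := priv a av; exists (inr b).
      by rewrite incidence_adj /s' (negPf av).
    rewrite incidence_degreer -(cards1 a); apply/subset_leq_card/subsetP => a'.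
    rewrite !inE /s'; have [_|a'v] := eqVneq a' v; first by rewrite inE.
    by move/(pb _ a'v)->.
apply/subsetP => -[a|b]; rewrite !inE ?andbF // andbT (inj_eq inl_inj) => av.
by rewrite /s' (negPf av) -card_gt0 s2.
Qed.

(** * Pairs selected by a matching that covers all hyperedges *)

Section Selection.

Variables (h : A -> {set B}) (F : graph (A + B)%type).
Hypotheses (h0 : forall a, h a != set0) (matF : matching24 (incidence h) lefts F).
Hypothesis coverF : covers F lefts.

Definition selection a : {set B} := [set b | adj F (inl a) (inr b)].

Lemma selection_sub a : selection a \subset h a.
Proof.
have [sFG _ _] := matF; apply/subsetP => b.
by rewrite inE => /(subgraph_adj sFG); rewrite incidence_adj.
Qed.

Lemma card_selection a : #|selection a| = 2.
Proof.
have [sFG _ degF] := matF.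
have aL : inl a \in lefts by rewrite inE.
rewrite -(degF (inl a)) ?inE ?(subsetP coverF) //.
rewrite -(card_imset _ (@inr_inj A B)); apply: eq_card => y.
apply/imsetP/idP => [[b + ->]|]; rewrite !inE // => ay.
have [a' [b [_ [] [] // _ Dy]]] := incidence_adjP (subgraph_adj sFG ay).
by exists b; rewrite // inE -Dy.
Qed.

(** The shared points put three vertices of [lefts] in one component. *)
Lemma selection_path a1 a2 a3 b1 b2 : a1 != a2 -> a1 != a3 -> a2 != a3 ->
  b1 \in selection a1 -> b1 \in selection a2 ->
  b2 \in selection a2 -> b2 \in selection a3 -> False.
Proof.
rewrite !inE => a12 a13 a23 ab11 ab21 ab22 ab32.
have conn a a' b : adj F (inl a) (inr b) -> adj F (inl a') (inr b) ->
    connect (adj F) (inl a) (inl a').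
  move=> ab a'b; apply: connect_trans (connect1 ab) (connect1 _).
  by rewrite adjC.
apply: (matching24_component (x := inl a2) (y := inl a1) (z := inl a3)
  (incidence_bipartition h0) matF coverF); rewrite ?inE //.
- by rewrite eq_sym (inj_eq inl_inj).
- exact: conn ab21 ab11.
- exact: conn ab22 ab32.
Qed.

(** A selection has exactly two points, so excluding all but two candidates determines it. *)
Lemma selection_pair a b c : selection a \subset [set b; c] ->
  b \in selection a /\ c \in selection a.
Proof.
move=> sbc; have /eqP-> : selection a == [set b; c].
  by rewrite eqEcard sbc card_selection cards2; case: (b != c).
by rewrite !inE !eqxx orbT.
Qed.

End Selection.
End IncidenceGraph.

(* He i, Hf i, Hg i stand for e_i, f_i, g_i and Pp i, Pb i, ... for the points
   p_i, b_i, ...; the point Pq k exists but lies in no hyperedge. *)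
Variant hyperedge (n : nat) : predArgType := He of 'I_n | Hf of 'I_n | Hg of 'I_n.
Variant point (n : nat) : predArgType :=
  Pp of 'I_n | Pb of 'I_n | Pc of 'I_n | Pr of 'I_n | Pq of 'I_n.

(** * Finiteness and cardinality of hyperedges and points *)

Section FiniteTypes.

Variable n : nat.

Definition hyperedge_code (a : hyperedge n) : 'I_n + 'I_n + 'I_n :=
  match a with
  | He i => inl (inl i) | Hf i => inl (inr i) | Hg i => inr i
  end.

Definition hyperedge_decode (x : 'I_n + 'I_n + 'I_n) : hyperedge n :=
  match x with
  | inl (inl i) => He i | inl (inr i) => Hf i | inr i => Hg i
  end.

Lemma hyperedge_codeK : cancel hyperedge_code hyperedge_decode.
Proof. by case. Qed.

Lemma hyperedge_decodeK : cancel hyperedge_decode hyperedge_code.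
Proof. by case=> [[]|]. Qed.

HB.instance Definition _ := Finite.copy (hyperedge n) (can_type hyperedge_codeK).

Definition point_code (b : point n) : 'I_n + 'I_n + 'I_n + 'I_n + 'I_n :=
  match b with
  | Pp i => inl (inl (inl (inl i))) | Pb i => inl (inl (inl (inr i)))
  | Pc i => inl (inl (inr i)) | Pr i => inl (inr i) | Pq i => inr i
  end.

Definition point_decode (x : 'I_n + 'I_n + 'I_n + 'I_n + 'I_n) : point n :=
  match x with
  | inl (inl (inl (inl i))) => Pp i | inl (inl (inl (inr i))) => Pb i
  | inl (inl (inr i)) => Pc i | inl (inr i) => Pr i | inr i => Pq i
  end.

Lemma point_codeK : cancel point_code point_decode.
Proof. by case. Qed.

Lemma point_decodeK : cancel point_decode point_code.
Proof. by case=> [[[[]|]|]|]. Qed.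

HB.instance Definition _ := Finite.copy (point n) (can_type point_codeK).

Lemma card_hyperedge : #|hyperedge n| = n * 3.
Proof.
rewrite (bij_eq_card (Bijective hyperedge_codeK hyperedge_decodeK)).
by rewrite !card_sum !card_ord !mulnS muln0 addn0 addnA.
Qed.

Lemma card_point : #|point n| = n * 5.
Proof.
rewrite (bij_eq_card (Bijective point_codeK point_decodeK)).
by rewrite !card_sum !card_ord !mulnS muln0 addn0 !addnA.
Qed.

End FiniteTypes.

(** * The chain hypergraph and its choices of pairs *)

Section Chain.

Variable k : nat.
Notation I := 'I_k.+1.

(** The test [i < k] removes q_k from e_k. Writing [j.+1 == i] instead of a predecessor leaves no
    solution at [i = 0], which removes q_(-1). *)
Definition chain_mem (a : hyperedge k.+1) (b : point k.+1) : bool :=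
  match a, b with
  | He i, Pp j | He i, Pb j | Hf i, Pb j | Hf i, Pc j => j == i
  | Hg i, Pp j | Hg i, Pr j => j == i
  | He i, Pq j => (j == i) && (i < k)
  | Hg i, Pq j => j.+1 == i :> nat
  | _, _ => false
  end.

Definition chain a : {set point k.+1} := [set b | chain_mem a b].

(* The choice of pairs when a hyperedge of level t is deleted: below t the
   pairs propagate upwards along the p's, above t downwards along the q's. *)
Definition choice_mem (t : I) (a : hyperedge k.+1) (b : point k.+1) : bool :=
  match a, b with
  | He i, Pb j | Hf i, Pb j | Hf i, Pc j | Hg i, Pr j => j == i
  | He i, Pq j => (j == i) && (i < t)
  | He i, Pp j => (j == i) && (t <= i)
  | Hg i, Pp j => (j == i) && (i <= t)
  | Hg i, Pq j => (j.+1 == i :> nat) && (t < i)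
  | _, _ => false
  end.

Definition choice t a : {set point k.+1} := [set b | choice_mem t a b].

Definition level a : I := match a with He i | Hf i | Hg i => i end.

Lemma chain_neq0 a : chain a != set0.
Proof.
apply/set0Pn; case: a => i; [exists (Pp i)|exists (Pb i)|exists (Pp i)];
  by rewrite inE /= eqxx.
Qed.

(** f_i and g_i own the points c_i and r_i, and only e_i contains both p_i and b_i. *)
Lemma chain_inj : injective chain.
Proof.
move=> a a' /setP eq_aa'; case: a eq_aa' => i eq_i.
- have := eq_i (Pb i); have := eq_i (Pp i); rewrite !inE /= eqxx.
  by case: a' {eq_i} => j //= /esym/eqP->.
- by have := eq_i (Pc i); rewrite !inE /= eqxx; case: a' {eq_i} => j //= /esym/eqP->.
- by have := eq_i (Pr i); rewrite !inE /= eqxx; case: a' {eq_i} => j //= /esym/eqP->.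
Qed.

Lemma inord_pred (i j : I) : j.+1 = i :> nat -> j = inord i.-1.
Proof. by move=> <-; rewrite inord_val. Qed.

Lemma card_set3_le (T : finType) (x y z : T) : #|[set x; y; z]| <= 3.
Proof.
rewrite (leq_trans (leq_card_setU _ _)) // cards1 cards2.
by case: (x != y).
Qed.

Lemma card_chain a : #|chain a| <= 3.
Proof.
(* Only an upper bound is needed: the repeated [Pc i] keeps the three-term shape, and the spurious
   [Pq] at [i = 0] is harmless. *)
pose S (a : hyperedge k.+1) := match a with
  | He i => [set Pp i; Pb i; Pq i]
  | Hf i => [set Pb i; Pc i; Pc i]
  | Hg i => [set Pp i; Pr i; Pq (inord i.-1)] end.
apply: (@leq_trans #|S a|); last by case: a => i; exact: card_set3_le.
apply/subset_leq_card/subsetP => b; rewrite inE.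
case: a b => i [] j //=; rewrite ?andbF //.
all: rewrite !inE.
all: try by move=> /eqP->; rewrite eqxx ?orbT.
  by move=> /andP[/eqP-> _]; rewrite eqxx ?orbT.
by move=> /eqP/inord_pred->; rewrite eqxx ?orbT.
Qed.

Lemma chain_degree b : #|[set a | b \in chain a]| <= 2.
Proof.
(* For [i = k] the term [inord i.+1] is a default value, harmless in an upper bound. *)
pose S (b : point k.+1) := match b with
  | Pp i => [set He i; Hg i]
  | Pb i => [set He i; Hf i]
  | Pc i => [set Hf i; Hf i]
  | Pr i => [set Hg i; Hg i]
  | Pq i => [set He i; Hg (inord i.+1)] end.
apply: (@leq_trans #|S b|); last first.
  by case: b => i; rewrite cards2 //; case: (_ != _).
apply/subset_leq_card/subsetP => a; rewrite !inE.
case: a b => i [] j //=.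
all: rewrite !inE.
all: try by move=> /eqP->; rewrite eqxx ?orbT.
  by move=> /andP[/eqP-> _]; rewrite eqxx ?orbT.
by move=> /eqP->; rewrite inord_val eqxx ?orbT.
Qed.

(** The point q_i is chosen in e_i only for [i < t], and [t <= k], so the omitted q_k never
    occurs. *)
Lemma choice_sub t a : choice t a \subset chain a.
Proof.
apply/subsetP => b; rewrite !inE; case: a b => i [] j //=.
- by case/andP.
- by case/andP=> -> /leq_trans; apply; rewrite -ltnS.
- by case/andP.
- by case/andP.
Qed.

Lemma card_choice t a : #|choice t a| = 2.
Proof.
pose S (a : hyperedge k.+1) := match a with
  | He i => [set Pb i; if i < t then Pq i else Pp i]
  | Hf i => [set Pb i; Pc i]
  | Hg i => [set Pr i; if i <= t then Pp i else Pq (inord i.-1)] end.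
have -> : choice t a = S a.
  apply/setP => b; rewrite inE; case: a => i /=.
  - by case: b (ltnP i t) => j [] it; rewrite !inE /= ?andbT ?andbF // orbC.
  - by case: b => j; rewrite !inE /= // orbC.
  - case: b (leqP i t) => j [] it; rewrite !inE /= ?andbT ?andbF //.
    + by rewrite orbC.
    + by rewrite orbC.
    + apply/eqP/eqP => [/inord_pred->//|[->]].
      (* In this branch [t < i], so [i.-1] is a true predecessor. *)
      have i0 : 0 < i := leq_ltn_trans (leq0n t) it.
      by rewrite inordK prednK // ltnW.
by case: a => i; rewrite cards2 //; case: ifP.
Qed.

(** f_i keeps c_i and g_i keeps r_i. With t the level of [v], e_i keeps q_i for [i < t], since
    g_(i+1) then uses p_(i+1), and keeps p_i for [i > t], since g_i then uses q_(i-1). *)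
Lemma choice_private v a : a != v ->
  exists2 b, b \in choice (level v) a &
    forall a', a' != v -> b \in choice (level v) a' -> a' = a.
Proof.
case: a => i av; last 2 first.
- by exists (Pc i) => [|[]j _]; rewrite !inE //= => /eqP->.
- by exists (Pr i) => [|[]j _]; rewrite !inE //= => /eqP->.
have [it|ti|/val_inj Dt] := ltngtP i (level v).
- exists (Pq i) => [|[]j _]; rewrite !inE //= ?eqxx //.
    by case/andP=> /eqP->.
  by case/andP=> /eqP<-; rewrite ltnS leqNgt it.
- exists (Pp i) => [|[]j _]; rewrite !inE //= ?eqxx ?(ltnW ti) //.
    by case/andP=> /eqP->.
  by case/andP=> /eqP<-; rewrite leqNgt ti.
(* e_t shares b_t with f_t and p_t with g_t; the deletion of f_t or g_t frees one of them. *)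
case: v av Dt => t av /= Dt; rewrite {}Dt in av *.
- by rewrite eqxx in av.
- exists (Pb t) => [|[]j jt]; rewrite !inE //= => /eqP Dj.
    by rewrite Dj.
  by rewrite Dj eqxx in jt.
- exists (Pp t) => [|[]j jt]; rewrite !inE /= ?eqxx ?leqnn //.
    by case/andP=> /eqP->.
  by case/andP=> /eqP Dj; rewrite Dj eqxx in jt.
Qed.

(** Every point except [Pq ord_max] lies in some hyperedge. *)
Lemma card_nbhd_chain : k.+1 * 5 <= #|nbhd (incidence chain) (lefts _ _)|.+1.
Proof.
have := cardC1 (Pq (ord_max : I)); rewrite card_point => cC.
rewrite -[_ * 5]prednK // ltnS -cC -(card_imset (predC1 _) (@inr_inj (hyperedge k.+1) _)).
apply/subset_leq_card/subsetP => _ /imsetP[b bq ->].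
have [a ba] : exists a, b \in chain a.
  case: b bq => i; rewrite !inE /= => iq.
  - by exists (He i); rewrite inE /=.
  - by exists (He i); rewrite inE /=.
  - by exists (Hf i); rewrite inE /=.
  - by exists (Hg i); rewrite inE /=.
  exists (He i); rewrite inE /= eqxx /= ltn_neqAle -ltnS ltn_ord andbT.
  by apply: contra iq => /eqP Di; apply/eqP; congr Pq; apply: val_inj.
by apply/bigcupP; exists (inl a); rewrite !inE // incidence_adj.
Qed.

(** * Proper subsets are coverable, the whole side is not *)

Lemma chain_coverable (S : {set hyperedge k.+1 + point k.+1}) :
  S \proper lefts _ _ -> coverable24 (incidence chain) (lefts _ _) S.
Proof.
case/properP=> sSL [[v|b]]; rewrite !inE // => _ vS.
have [F [matF covF]] := incidence_matching chain_neq0 chain_degree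
  (choice_sub (level v)) (card_choice (level v)) (choice_private (v := v)).
exists F; split=> //; apply: subset_trans covF; apply/subsetP => x xS.
by rewrite !inE; apply/andP; split;
  [apply: contraNneq vS => <-|have := subsetP sSL x xS; rewrite inE].
Qed.

Lemma chain_not_coverable :
  ~ coverable24 (incidence chain) (lefts _ _) (lefts _ _).
Proof.
case=> F [matF covF]; pose s := selection F.
have path3 := selection_path chain_neq0 matF covF.
have pair a b c : (forall x, chain_mem a x -> x \in s a -> x = b \/ x = c) ->
    b \in s a /\ c \in s a.
  move=> sub_bc; apply: (selection_pair matF covF); apply/subsetP => x xs.
  have := subsetP (selection_sub matF a) x xs; rewrite inE => /sub_bc/(_ xs).
  by rewrite !inE => -[->|->]; rewrite eqxx ?orbT.
(* f_i has only two points, so its pair is forced. *)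
have sf i : Pb i \in s (Hf i).
  by have [] // := pair (Hf i) (Pb i) (Pc i) => -[] j //= /eqP->; auto.
(* Propagation along the chain, by induction on a natural number; g_0 starts it because it consists
   of p_0 and r_0 only. *)
have sg n : n <= k -> Pp (inord n) \in s (Hg (inord n)).
  elim: n => [|n IHn] le_nk.
    have [] // := pair (Hg (inord 0)) (Pp (inord 0)) (Pr (inord 0)).
    by case=> j //=; [move/eqP->; left|move/eqP->; right|rewrite inordK].
  have {IHn} := IHn (ltnW le_nk).
  set i : I := inord n; set i' : I := inord n.+1 => pi.
  have Di : i = n :> nat by rewrite inordK // ltnW.
  have Di' : i' = n.+1 :> nat by rewrite inordK.
  have ii' : i != i' by rewrite -val_eqE /= Di Di' neq_ltn leqnn.
  apply/negPn/negP => pi'.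
  have [_ qi'] : Pr i' \in s (Hg i') /\ Pq i \in s (Hg i').
    apply: pair => -[] j //= => [/eqP->|/eqP->|/eqP Dj].
    - by rewrite (negPf pi').
    - by left.
    - by right; congr Pq; apply: val_inj; rewrite /= Di; move: Dj; rewrite Di' => -[].
  (* The pair of e_i is {p_i, q_i}, {b_i, q_i} or {p_i, b_i}; it links g_i with g_(i+1), f_i with
     g_(i+1), or g_i with f_i respectively. *)
  have [qi|qi] := boolP (Pq i \in s (He i)).
    have [pe|pe] := boolP (Pp i \in s (He i)).
      by apply: (path3 (Hg i) (He i) (Hg i') (Pp i) (Pq i)).
    have [be _] : Pb i \in s (He i) /\ Pq i \in s (He i).
      apply: pair => -[] j //=.
      - by move/eqP->; rewrite (negPf pe).
      - by move/eqP->; left.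
      - by case/andP=> /eqP-> _; right.
    by apply: (path3 (Hf i) (He i) (Hg i') (Pb i) (Pq i)).
  have [pe be] : Pp i \in s (He i) /\ Pb i \in s (He i).
    apply: pair => -[] j //=; try by move/eqP->; auto.
    by case/andP=> /eqP-> _; rewrite (negPf qi).
  by apply: (path3 (Hg i) (He i) (Hf i) (Pp i) (Pb i)).
(* At the end of the chain e_k lacks q_k, so its pair is forced. *)
have [pe be] : Pp ord_max \in s (He ord_max) /\ Pb ord_max \in s (He ord_max).
  apply: pair => -[] j //=; try by move/eqP->; auto.
  by rewrite ltnn andbF.
have := sg k (leqnn k); have -> : inord k = ord_max :> I.
  by apply: val_inj; rewrite /= inordK.
by move=> pg; apply: (path3 (Hg ord_max) (He ord_max) (Hf ord_max) _ _ _ _ _ pg pe be).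
Qed.

End Chain.

(** * Choice of the chain length and conclusion *)

Local Open Scope ring_scope.

Theorem theorem4 (K : realType) (eps : K) (heps : 1 / 3 < eps) :
  exists (T : finType) (G : graph T) (L R : {set T}),
    [/\ bipartition G L R,
        {in L, forall v, (degree G v <= 3)%N} &
        {in L &, forall u v, u != v -> degree G u = 3%N -> degree G v = 3%N ->
           neighbours G u <> neighbours G v}] /\
    [/\ (2 - eps) * #|L|%:R <= #|nbhd G L|%:R,
        (forall A : {set T}, A \proper L -> coverable24 G L A) &
        ~ coverable24 G L L].
Proof.
(* This is (2 - eps) * 3(k+1) <= 5(k+1) - 1 rearranged; the Archimedean property provides [k]. *)
have [k hk] : exists k : nat, 1 <= (eps - 1 / 3) * (k.+1 * 3)%:R.
  have d0 : 0 < eps - 1 / 3 by rewrite subr_gt0.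
  exists (Num.bound (eps - 1 / 3)^-1); rewrite -ler_pdivrMl // mulr1.
  apply: (le_trans (ltW (archi_boundP _))); first by rewrite invr_ge0 ltW.
  by rewrite ler_nat (leq_trans (leqnSn _)) // leq_pmulr.
exists _, (incidence (@chain k)), (lefts _ _), (rights _ _); split; split.
- exact: incidence_bipartition (@chain_neq0 k).
- by case=> [a|b]; rewrite !inE // incidence_degreel card_chain.
- case=> [a|b] [a'|b']; rewrite !inE // => _ _ aa' _ _ eqN.
  move: aa'; rewrite (inj_eq inl_inj) => /eqP; apply; apply: chain_inj.
  by move: eqN; rewrite !incidence_neighbours => /(imset_inj inr_inj).
- rewrite card_lefts card_hyperedge.
  have := card_nbhd_chain k; rewrite -(ler_nat K) -natr1 !natrM.
  by move: hk; rewrite natrM; lra.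
- exact: chain_coverable.
- exact: chain_not_coverable.
Qed.
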